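(* Let $\mathcal{B}\in\mathcal{A}^q$ be a non-empty system and let $w=\begin{bmatrix}u\\ y\end{bmatrix}$ be an input-output partition of $\mathcal{B}$, where $u(t)\in\mathbb{R}^m$ is an input and $y(t)\in\mathbb{R}^p$ is an output, with $p=q-m$. Let $P\in\mathbb{R}^{p\times p}[\xi]$ and $Q\in\mathbb{R}^{p\times m}[\xi]$. Then $$\mathcal{B}=\left\{w=\begin{bmatrix}u\\ y\end{bmatrix}\ \middle|\ P(\sigma)y=Q(\sigma)u+c\right\}$$ for some $c\in\mathbb{R}^p$ if and only if $$\mathcal{B}_{\mathrm{dif}}=\left\{w=\begin{bmatrix}u\\ y\end{bmatrix}\ \middle|\ P(\sigma)y=Q(\sigma)u\right\}.$$
   Context: A system (behavior) is a subset $\mathcal{B}\subseteq(\mathbb{R}^q)^{\mathbb{Z}}$. The shift is $(\sigma w)(t)=w(t+1)$. $\mathcal{B}$ is affine if $v,w\in\mathcal{B}$, $\alpha\in\mathbb{R}$ imply $\alpha v+(1-\alpha)w\in\mathcal{B}$; time-invariant if $\sigma\mathcal{B}=\mathcal{B}$; complete if $w\in\mathcal{B}$ holds if and only if $w|_{[t_0,t_1]}\in\mathcal{B}|_{[t_0,t_1]}$ for all integers $t_0<t_1$, where $\mathcal{B}|_{[t_0,t_1]}$ is the set of restrictions of elements of $\mathcal{B}$ to $[t_0,t_1]$. $\mathcal{A}^q$ is the class of all complete affine time-invariant systems in $(\mathbb{R}^q)^{\mathbb{Z}}$. The difference system is $\mathcal{B}_{\mathrm{dif}}:=\mathcal{B}-\mathcal{B}=\{a-b\mid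 a,b\in\mathcal{B}\}$. $\mathbb{R}^{g\times q}[\xi]$ is the set of $g\times q$ real polynomial matrices; a polynomial matrix $R(\xi)=\sum_{i=0}^d R_i\xi^i$ acts on sequences by $(R(\sigma)w)(t)=\sum_{i=0}^d R_iw(t+i)$. A vector $c\in\mathbb{R}^p$ is identified with the constant sequence with value $c$. For a partition $w=\begin{bmatrix}u\\ y\end{bmatrix}$ with $u(t)\in\mathbb{R}^m$, $y(t)\in\mathbb{R}^p$: $u$ is free for $\mathcal{B}$ if for every sequence $u\in(\mathbb{R}^m)^{\mathbb{Z}}$ there is $y$ with $\begin{bmatrix}u\\ y\end{bmatrix}\in\mathcal{B}$; it is maximally free if it is free and none of the components of $y$ can be chosen freely in addition (for no component $y_i$ of $y$ is $(u,y_i)$ free). If $u$ is maximally free, $u$ is called an input, $y$ an output, and the partition an input-output partition. *)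

(* Defs.v *)
From mathcomp Require Import all_boot all_order all_algebra.
From mathcomp Require Import all_classical all_reals.
Set Implicit Arguments.
Unset Strict Implicit.
Unset Printing Implicit Defensive.
Import Order.TTheory GRing.Theory Num.Theory.
Local Open Scope classical_set_scope.
Local Open Scope ring_scope.

Notation traj R q := (int -> 'cV[R]_q).

Definition behavior (R : realType) (q : nat) : Type := set (traj R q).

Section Behaviors.
Variables (R : realType) (q : nat).
Implicit Types (w : traj R q) (B : behavior R q).

Definition shift w : traj R q := fun t => w (t + 1).

Definition affine B : Prop :=
  forall (v w : traj R q) (a : R), B v -> B w -> B (a *: v + (1 - a) *: w).

Definition time_invariant B : Prop := shift @` B = B.

Definition restr (t0 t1 : int) w : {t : int | t0 <= t <= t1} -> 'cV[R]_q :=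
  fun t => w (val t).

Arguments restr t0 t1 w : clear implicits.

Definition complete B : Prop :=
  forall w, B w <->
    (forall t0 t1 : int, t0 < t1 -> (restr t0 t1 @` B) (restr t0 t1 w)).

(* The empty behavior belongs to this class. *)
Definition complete_affine_ti B : Prop :=
  [/\ complete B, affine B & time_invariant B].

Definition difference B : behavior R q := [set a - b | a in B & b in B].

End Behaviors.

Section PolynomialMatrices.
Variables (R : realType) (g q : nat).
Implicit Type M : 'M[{poly R}]_(g, q).

(* One more than the degree of M; 0 when M = 0. *)
Definition pmx_size M : nat := \max_(i < g) \max_(j < q) size (M i j).

Definition pmx_coef M (k : nat) : 'M[R]_(g, q) := \matrix_(i, j) (M i j)`_k.

Definition pmx_shift M (w : traj R q) : traj R g :=
  fun t => \sum_(k < pmx_size M) pmx_coef M k *m w (t + k%:Z).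

End PolynomialMatrices.

Section Partitions.
Variables (R : realType) (m p : nat).

Definition stack (u : traj R m) (y : traj R p) : traj R (m + p) :=
  fun t => col_mx (u t) (y t).

Definition free (B : behavior R (m + p)) : Prop :=
  forall u : traj R m, exists y : traj R p, B (stack u y).

(* The pair of u and the i-th component of y is free. *)
Definition free_with (B : behavior R (m + p)) (i : 'I_p) : Prop :=
  forall (u : traj R m) (v : int -> R),
    exists y : traj R p, (forall t, y t i ord0 = v t) /\ B (stack u y).

Definition maximally_free (B : behavior R (m + p)) : Prop :=
  free B /\ forall i : 'I_p, ~ free_with B i.

End Partitions.

(* Main.v *)
(** Write [L w = P(sigma) y - Q(sigma) u], a linear operator commuting with the
    shift. If [B - B] is the kernel of [L] and [b] is in [B], then affineness
    gives [B = b + ker L], that is, [B] is the solution set of [L w = L b].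
    Time invariance puts [shift b - b] in [B - B], so [L b] is shift-invariant,
    hence constant. *)
Require Import Defs.
From mathcomp Require Import all_boot all_order all_algebra.
From mathcomp Require Import all_classical all_reals.
Set Implicit Arguments.
Unset Strict Implicit.
Unset Printing Implicit Defensive.
Import Order.TTheory GRing.Theory Num.Theory.
Local Open Scope classical_set_scope.
Local Open Scope ring_scope.

Lemma int_periodic1_cst (T : Type) (f : int -> T) :
  (forall t, f (t + 1) = f t) -> forall t, f t = f 0.
Proof.
move=> fS; elim/int_rect => [//|n IHn|n IHn].
- by rewrite intS addrC fS.
- by rewrite -fS intS opprD addrAC addNr add0r.
Qed.

Lemma pmx_shiftB (R : realType) (g q : nat) (M : 'M[{poly R}]_(g, q))
    (v w : traj R q) :
  pmx_shift M (v - w) = pmx_shift M v - pmx_shift M w.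
Proof.
apply/funext => t; rewrite /pmx_shift !fctE -sumrB.
by apply: eq_bigr => k _; rewrite mulmxBr.
Qed.

Lemma pmx_shift_shift (R : realType) (g q : nat) (M : 'M[{poly R}]_(g, q))
    (w : traj R q) :
  pmx_shift M (shift w) = shift (pmx_shift M w).
Proof.
apply/funext => t; rewrite /pmx_shift /shift.
by apply: eq_bigr => k _; rewrite addrAC.
Qed.

(** Two affine combinations suffice: the midpoint of [a] and [c], extrapolated away from [b] with
    weight 2, is [2 *: ((a + c) / 2) - b]. *)
Lemma affine_addB (R : realType) (q : nat) (B : behavior R q)
    (a b c : traj R q) :
  affine B -> B a -> B b -> B c -> B (a - b + c).
Proof.
move=> Baff Ba Bb Bc.
have := Baff _ _ 2 (Baff _ _ 2^-1 Ba Bc) Bb; congr B.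
have two_neq0 : 2 != 0 :> R by rewrite pnatr_eq0.
have -> : 1 - 2^-1 = 2^-1 :> R.
  by apply: (mulfI two_neq0); rewrite mulrBr mulfV // mulr1 addrK.
have -> : 1 - 2 = -1 :> R by rewrite opprD addrA subrr add0r.
by rewrite -scalerDr scalerA mulfV // scale1r scaleN1r addrAC.
Qed.

(** For the converse, [w - b = a - a'] gives [w = a - a' + b], a combination with weights summing to
    1. Any element of [B] can thus serve as base point. *)
Lemma difference_affine (R : realType) (q : nat) (B : behavior R q)
    (b w : traj R q) :
  affine B -> B b -> B w <-> difference B (w - b).
Proof.
move=> Baff Bb; split=> [Bw|[a Ba [a' Ba' wE]]]; first by exists w => //; exists b.
by rewrite -(subrK b w) -wE; apply: affine_addB.
Qed.

Section Residual.
Variables (R : realType) (m p : nat).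
Variables (P : 'M[{poly R}]_(p, p)) (Q : 'M[{poly R}]_(p, m)).
Implicit Types (v w : traj R (m + p)) (f : traj R p).

(** Defined on the unsplit trajectory, so that both systems of equations become level sets of one
    additive map. *)
Definition residual w : traj R p :=
  pmx_shift P (fun t => dsubmx (w t)) - pmx_shift Q (fun t => usubmx (w t)).

Lemma residualB v w : residual (v - w) = residual v - residual w.
Proof.
rewrite /residual.
have -> : (fun t => dsubmx ((v - w) t)) =
    (fun t => dsubmx (v t)) - (fun t => dsubmx (w t)).
  by apply/funext => t; rewrite !fctE linearB.
have -> : (fun t => usubmx ((v - w) t)) =
    (fun t => usubmx (v t)) - (fun t => usubmx (w t)).
  by apply/funext => t; rewrite !fctE linearB.
by rewrite !pmx_shiftB [in LHS]opprB [in RHS]opprB addrACA [RHS]addrACA (addrC (- _)).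
Qed.

Lemma residual_shift w : residual (shift w) = shift (residual w).
Proof.
have dE := pmx_shift_shift P (fun t => dsubmx (w t)).
have uE := pmx_shift_shift Q (fun t => usubmx (w t)).
by rewrite /residual dE uE.
Qed.

(** Every trajectory splits uniquely into its upper block [u] and lower block [y], so the
    existential quantifiers only name these blocks. *)
Lemma residualE f :
  [set w | exists (u : traj R m) (y : traj R p),
     w = stack u y /\ pmx_shift P y = pmx_shift Q u + f] =
  [set w | residual w = f].
Proof.
apply/seteqP; split=> w /=.
- move=> [u [y [-> Pyu]]]; rewrite /residual.
  have -> : (fun t => dsubmx (stack u y t)) = y.
    by apply/funext => t; rewrite col_mxKd.
  have -> : (fun t => usubmx (stack u y t)) = u.
    by apply/funext => t; rewrite col_mxKu.
  by rewrite Pyu addrC addKr.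
- move=> <-; exists (fun t => usubmx (w t)), (fun t => dsubmx (w t)).
  split; first by apply/funext => t; rewrite /stack vsubmxK.
  by rewrite addrC subrK.
Qed.

Lemma residual0E :
  [set w | exists (u : traj R m) (y : traj R p),
     w = stack u y /\ pmx_shift P y = pmx_shift Q u] =
  [set w | residual w = 0].
Proof.
rewrite -residualE; apply/seteqP; split=> w [u [y [wE Pyu]]].
- by exists u, y; rewrite addr0.
- by exists u, y; rewrite addr0 in Pyu.
Qed.

End Residual.

Theorem corollary1 (R : realType) (m p : nat) (B : behavior R (m + p))
    (B_cat : complete_affine_ti B) (B_ne : B !=set0)
    (B_io : maximally_free B)
    (P : 'M[{poly R}]_(p, p)) (Q : 'M[{poly R}]_(p, m)) :
  (exists c : 'cV[R]_p,
     B = [set w | exists (u : traj R m) (y : traj R p),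
            w = stack u y /\ pmx_shift P y = pmx_shift Q u + cst c])
  <->
  difference B = [set w | exists (u : traj R m) (y : traj R p),
                    w = stack u y /\ pmx_shift P y = pmx_shift Q u].
Proof.
have [_ Baff Bti] := B_cat; have [b Bb] := B_ne.
rewrite residual0E; split=> [[c]|BD].
- rewrite residualE => BE; apply/seteqP; split=> [_ [a + [a' + <-]]|w /= w0].
    by rewrite BE /= residualB => -> ->; rewrite subrr.
  (* Since [w = (w + b) - b], it suffices that [w + b] lies in [B]: adding [w], whose residual is 0,
     leaves the residual of [b] equal to [c]. *)
  rewrite -(addrK b w); apply/(difference_affine _ Baff Bb).
  move: Bb (residualB P Q (w + b) b); rewrite BE /= addrK w0 => ->.
  by move=> /esym /subr0_eq.
- have BE w : B w <-> residual P Q w = residual P Q b.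
    rewrite (difference_affine w Baff Bb) BD /= residualB.
    by split=> [/subr0_eq //|->]; rewrite subrr.
  have resS t : residual P Q b (t + 1) = residual P Q b t.
    (* Here [BE] is applied to the trajectory [shift b]: its residual equals that of [b], and is
       also the shift of that residual. *)
    have /BE : B (shift b) by rewrite -Bti; exists b.
    by rewrite residual_shift => /(congr1 (fun f => f t)).
  (* The residual of [b] is constant in time, so its value at time 0 represents the whole
     sequence. *)
  exists (residual P Q b 0); rewrite residualE; apply/seteqP.
  have -> : cst (residual P Q b 0) = residual P Q b.
    by apply/funext => t; rewrite -(int_periodic1_cst resS t).
  by split=> w /BE.
Qed.
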